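(* Fix a constant $r\ge 1$. There is a constant $c_r$ (depending only on $r$) such that for every connected unweighted $K_r$-minor-free graph $G$ with $n$ vertices and diameter $\Delta$, there is a collection $\mathcal{F}$ of at most $2^{c_r\Delta}$ trees, each of which is a subgraph of $G$, such that for every $u,v\in V(G)$ there is a tree $T\in\mathcal{F}$ containing $u$ and $v$ with $d_T(u,v)=\delta_G(u,v)$.
   Context: $G$ is unweighted: every edge has length 1 and $\delta_G$ is the hop-distance. $K_r$-minor-free means $G$ does not contain the complete graph $K_r$ as a minor. $d_T$ denotes the distance in the tree $T$. (Since each tree is a subgraph of $G$, $d_T\ge\delta_G$ automatically.) *)

(* Defs.v *)
From mathcomp Require Import all_boot.
Set Implicit Arguments. Unset Strict Implicit. Unset Printing Implicit Defensive.

(* A simple graph on a finite vertex type T is a symmetric irreflexive e : rel T. *)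

Definition walk_of_len (T : finType) (e : rel T) (x y : T) (k : nat) : bool :=
  [exists p : k.-tuple T, path e x p && (last x p == y)].

Lemma dist_ex (T : finType) (e : rel T) (x y : T) :
  exists k, walk_of_len e x y k || (#|T| <= k).
Proof. by exists #|T|; rewrite leqnn orbT. Qed.

(* hop distance: length of a shortest walk (capped at #|T|, which is only
   reached when y is unreachable from x) *)
Definition dist (T : finType) (e : rel T) (x y : T) : nat :=
  ex_minn (dist_ex e x y).

Definition connected_graph (T : finType) (e : rel T) : Prop :=
  forall x y : T, connect e x y.

Definition diameter (T : finType) (e : rel T) : nat :=
  \max_(p : T * T) dist e p.1 p.2.

Definition induced (T : finType) (e : rel T) (B : {set T}) : rel T :=
  fun x y => [&& e x y, x \in B & y \in B].

(* K_r minor, given by a branch-set model *)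
Definition has_K_minor (T : finType) (e : rel T) (r : nat) : Prop :=
  exists B : 'I_r -> {set T},
    [/\ forall i, B i != set0,
        forall i x y, x \in B i -> y \in B i -> connect (induced e (B i)) x y,
        forall i j, i != j -> [disjoint B i & B j] &
        forall i j, i != j -> exists x y, [/\ x \in B i, y \in B j & e x y]].

(* A tree (Vt, Et) with Et : {set T * T} its (symmetric) edge relation. *)
Definition tree_rel (T : finType) (Et : {set T * T}) : rel T :=
  fun x y => (x, y) \in Et.

Definition acyclic (T : finType) (f : rel T) : Prop :=
  forall c : seq T, uniq c -> 2 < size c -> ~~ cycle f c.

Definition subtree_of (T : finType) (e : rel T) (t : {set T} * {set T * T}) : Prop :=
  let (Vt, Et) := t in
  [/\ Vt != set0,
      forall x y, (x, y) \in Et -> [/\ e x y, x \in Vt, y \in Vt & (y, x) \in Et],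
      forall x y, x \in Vt -> y \in Vt -> connect (tree_rel Et) x y &
      acyclic (tree_rel Et)].

(* Main.v *)
Require Import Defs.
From mathcomp Require Import all_boot.
From mathcomp Require Import zify.
Set Implicit Arguments. Unset Strict Implicit. Unset Printing Implicit Defensive.

(* Remove connected blocks one after the other: take a component [C] of what is
   left, and remove a union of geodesics of [G[C]] that issue from one vertex and
   reach every earlier block adjacent to [C]. These earlier blocks are pairwise
   adjacent, so together with [C] they form a clique minor, and there are fewer
   than [r] of them. Write [node m] for the component from which the block of [m]
   was removed. Every path [P] contains some [m] with [P] inside [node m], so a
   BFS tree of [G[node m]] rooted at [m] preserves the distance between the ends
   of [P] when [P] is a shortest path. A vertex [x] is within distance [k] of [m]
   in [G[node m]] for at most [r^k * r(2k+1)] vertices [m]: moving from [x] to [m],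
   each newly entered block has fewer than [r] possibilities, and a block that
   consists of [r] geodesics meets a [k]-ball in at most [r(2k+1)] vertices. Taking
   [k] to be twice the diameter and colouring the [m] greedily by decreasing size of
   [node m], that many colours make the balls of radius [diameter] of the same
   colour disjoint; the BFS trees of one colour then extend to one spanning tree. *)

(** * Distances, colourings and spanning trees *)

Lemma dist_le (T : finType) (R : rel T) (x : T) (p : seq T) :
  path R x p -> dist R x (last x p) <= size p.
Proof.
move=> Rp; rewrite /dist; case: ex_minnP => k _; apply.
by apply/orP; left; apply/existsP; exists (in_tuple p); rewrite Rp eqxx.
Qed.

(** A walk without repeated vertices has fewer than [#|T|] steps, so for connected vertices the cap
    in [dist] is never the minimum. *)
Lemma dist_path (T : finType) (R : rel T) (x y : T) :
  connect R x y ->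
  exists p, [/\ path R x p, last x p = y & size p = dist R x y].
Proof.
move=> /connectP [p0 Rp0 ->].
case/shortenP: Rp0 => p Rp Up _ {p0}.
rewrite /dist; case: ex_minnP => k Pk min_k.
have le_kp : k <= size p.
  by apply: min_k; apply/orP; left; apply/existsP; exists (in_tuple p); rewrite Rp eqxx.
case/orP: Pk => [/existsP[q /andP[Rq /eqP lq]]|le_Tk].
  by exists q; rewrite size_tuple.
have := max_card (mem (x :: p)); rewrite (card_uniqP Up) /= => lt_pT.
by have := leq_trans (leq_trans lt_pT le_Tk) le_kp; rewrite ltnn.
Qed.

Lemma dist_xx (T : finType) (R : rel T) (x : T) : dist R x x = 0.
Proof. by apply/eqP; rewrite -leqn0; apply: (@dist_le _ R x [::]). Qed.

Lemma dist_triangle (T : finType) (R : rel T) (x y z : T) :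
  connect R x y -> connect R y z -> dist R x z <= dist R x y + dist R y z.
Proof.
move=> /dist_path [p [Rp lp <-]] /dist_path [q [Rq <- <-]].
rewrite -size_cat -lp -last_cat; apply: dist_le.
by rewrite cat_path Rp lp.
Qed.

Lemma dist_sym (T : finType) (R : rel T) (x y : T) :
  symmetric R -> connect R x y -> dist R x y = dist R y x.
Proof.
move=> symR.
have le u v : connect R u v -> dist R v u <= dist R u v.
  move=> /dist_path [p [Rp <- <-]].
  have Rr : path R (last u p) (rev (belast u p)).
    by rewrite rev_path (@eq_path _ _ R).
  have := dist_le Rr; rewrite size_rev size_belast.
  by case: p {Rp Rr} => //= a p; rewrite rev_cons last_rcons.
move=> Rxy; apply/eqP; rewrite eqn_leq !le //.
by rewrite (sym_connect_sym symR).
Qed.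

Lemma dist_sub (T : finType) (R R' : rel T) (x y : T) :
  subrel R R' -> connect R x y -> dist R' x y <= dist R x y.
Proof.
by move=> sRR' /dist_path [p [Rp <- <-]]; apply/dist_le/(sub_path sRR').
Qed.

Lemma dist_split (T : finType) (R : rel T) (x m : T) (p : seq T) :
  path R x p -> m \in x :: p ->
  [/\ connect R x m, connect R m (last x p) &
      dist R x m + dist R m (last x p) <= size p].
Proof.
move=> Rp; rewrite inE => /orP[/eqP ->|mp].
  split=> //; first by apply/connectP; exists p.
  by rewrite dist_xx; apply: dist_le.
case/splitPr: mp Rp => p1 p2; rewrite -cat_rcons cat_path last_rcons => /andP[R1 R2].
rewrite last_cat last_rcons size_cat; split.
- by apply/connectP; exists (rcons p1 m); rewrite ?last_rcons.
- by apply/connectP; exists p2.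
- by have := dist_le R1; rewrite last_rcons => le1; apply: leq_add le1 (dist_le R2).
Qed.

(** The pieces of [p] before and after [m] bound the two distances from above, and the triangle
    inequality forces equality. A vertex of a geodesic is thus recovered from its distance to the
    start, which allows counting by distances. *)
Lemma geodesic_mem (T : finType) (R : rel T) (x m : T) (p : seq T) :
  path R x p -> size p = dist R x (last x p) -> m \in p ->
  nth x (x :: p) (dist R x m) = m.
Proof.
move=> Rp geo mp.
have [k lt_kp Dm] : exists2 k, k < size p & m = nth x p k.
  by exists (index m p); rewrite ?index_mem ?nth_index.
have Rt : path R x (take k.+1 p) by move: Rp; rewrite -{1}(cat_take_drop k.+1 p) cat_path => /andP[].
have lt : last x (take k.+1 p) = m by rewrite (take_nth x lt_kp) last_rcons -Dm.
have Rd : path R m (drop k.+1 p).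
  by move: Rp; rewrite -{1}(cat_take_drop k.+1 p) cat_path lt => /andP[].
have ld : last m (drop k.+1 p) = last x p.
  by rewrite -{2}(cat_take_drop k.+1 p) last_cat lt.
have le1 : dist R x m <= k.+1.
  by have := dist_le Rt; rewrite lt size_takel.
have le2 : dist R m (last x p) <= size p - k.+1.
  by have := dist_le Rd; rewrite ld size_drop.
have c1 : connect R x m by apply/connectP; exists (take k.+1 p).
have c2 : connect R m (last x p) by apply/connectP; exists (drop k.+1 p).
have := dist_triangle c1 c2; rewrite -geo => le3.
have -> : dist R x m = k.+1 by lia.
by rewrite /= -Dm.
Qed.

(** Supplies parents for BFS trees: [y] is the last vertex but one of a shortest path from [m] to
    [x]. *)
Lemma dist_pred (T : finType) (R : rel T) (m x : T) :
  connect R m x -> x != m ->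
  exists y, [/\ connect R m y, R y x & dist R m x = (dist R m y).+1].
Proof.
move=> /dist_path [p [Rp <- geo]]; case/lastP: p Rp geo => [|q z] /=.
  by rewrite eqxx.
rewrite last_rcons rcons_path size_rcons => /andP[Rq Rz] geo _.
have c1 : connect R m (last m q) by apply/connectP; exists q.
exists (last m q); split=> //.
have le1 := dist_le Rq.
have le2 := dist_triangle c1 (connect1 Rz).
have le3 : dist R (last m q) z <= 1 by apply: (@dist_le _ R (last m q) [:: z]); rewrite /= Rz.
lia.
Qed.

Lemma ex_max_in (T : finType) (A : {pred T}) (h : T -> nat) (x0 : T) :
  x0 \in A -> exists2 x, x \in A & forall y, y \in A -> h y <= h x.
Proof.
by move=> x0A; have [x xA maxx] := @arg_maxnP T x0 (mem A) h x0A; exists x.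
Qed.

(** In each set the vertex with the largest [h] is coloured last. All its coloured conflicts then
    have smaller or equal [h], so they block fewer than [W] colours. *)
Lemma greedy_coloring (T : finType) (conf : rel T) (h : T -> nat) (W : nat) :
  symmetric conf ->
  (forall x, #|[set y | [&& y != x, conf x y & h y <= h x]]| < W) ->
  exists col : T -> nat, (forall x, col x < W) /\
    (forall x y, conf x y -> col x = col y -> x = y).
Proof.
move=> symc bound.
suff /(_ setT) [col colW colP] : forall S : {set T}, exists2 col : T -> nat,
    (forall x, x \in S -> col x < W) &
    (forall x y, x \in S -> y \in S -> conf x y -> col x = col y -> x = y).
  by exists col; split=> [x|x y]; [apply: colW|apply: colP]; rewrite ?inE.
move=> S; have [n] := ubnP #|S|; elim: n S => // n IHn S leSn.
have [->|[x0 x0S]] := set_0Vmem S.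
  by exists (fun=> 0) => x; rewrite ?inE.
have [x xS maxx] := ex_max_in h x0S.
have [|col colW colP] := IHn (S :\ x).
  by move: leSn; rewrite (cardsD1 x S) xS.
pose N := [set y | [&& y != x, conf x y & h y <= h x]].
have [c cW cN] : exists2 c, c < W & c \notin [seq col y | y in N].
  have [/hasP[c]|/hasPn none] := boolP (has (fun c => c \notin [seq col y | y in N]) (iota 0 W)).
    by rewrite mem_iota => cW cN; exists c.
  have sub : {subset iota 0 W <= [seq col y | y in N]}.
    by move=> c /none; rewrite negbK.
  have := uniq_leq_size (iota_uniq 0 W) sub.
  by rewrite size_iota size_image leqNgt bound.
have free y : y \in S -> y != x -> conf x y -> col y != c.
  move=> yS yx cxy; apply: contraNneq cN => <-; apply: image_f.
  by rewrite inE yx cxy; apply: maxx.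
exists (fun y => if y == x then c else col y) => [y yS|y z yS zS].
  by case: ifP => // yx; apply: colW; rewrite !inE yx.
case: (eqVneq y x) => [->|yx]; case: (eqVneq z x) => [->|zx] //.
- by move=> cxz E; have := free z zS zx cxz; rewrite E eqxx.
- by rewrite symc => cxy E; have := free y yS yx cxy; rewrite E eqxx.
- by apply: colP; rewrite !inE ?yx ?zx.
Qed.

(** * Forests and their extension to spanning trees *)

(** On a cycle, both neighbours of a vertex of maximal [h] would be its parent, hence equal. *)
Lemma acyclic_parent (T : finType) (f : rel T) (par : T -> T) (h : T -> nat) :
  symmetric f ->
  (forall x y, f x y -> par x = y /\ h y < h x \/ par y = x /\ h x < h y) ->
  acyclic f.
Proof.
move=> symf fP c Uc c_gt2; apply/negP => cyc.
have [x0 x0c] : exists x, x \in c by case: c c_gt2 {Uc cyc} => // a c _; exists a; rewrite inE eqxx.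
have [x xc maxx] := ex_max_in h x0c.
have up y : y \in c -> f x y -> par x = y.
  move=> yc /fP[[]//|[_ lt_xy]].
  by have := maxx y yc; rewrite leqNgt lt_xy.
have [i s Dc] := rot_to xc.
have : cycle f (x :: s) by rewrite -Dc rot_cycle.
have Us : uniq (x :: s) by rewrite -Dc rot_uniq.
have sz : 2 < size (x :: s) by rewrite -Dc size_rot.
have inc y : y \in x :: s -> y \in c by rewrite -Dc mem_rot.
case/lastP: s {Dc} Us sz inc => // s z; case: s => // y s Us _ inc.
rewrite /cycle rcons_path last_rcons => /andP[/andP[fxy _] fzx].
have py : par x = y by apply: up => //; apply: inc; rewrite !inE eqxx orbT.
have pz : par x = z.
  by apply: up; [apply: inc; rewrite in_cons mem_rcons inE eqxx orbT | rewrite symf].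
by move: Us; rewrite -py pz rcons_cons /= mem_rcons inE eqxx andbF.
Qed.

Lemma acyclic_add_edge (T : finType) (f : rel T) (a b : T) :
  symmetric f -> acyclic f -> ~~ connect f a b ->
  acyclic (fun x y => [|| f x y, (x == a) && (y == b) | (x == b) && (y == a)]).
Proof.
move=> symf acf ncab c Uc c_gt2; set f' := fun x y => _; apply/negP => cyc.
(* A cycle with all steps in [f] is excluded, so some step, from [x] to its successor, uses the new
   edge. *)
have [/allP fn|/allPn [x xc nf]] := boolP (all (fun x => f x (next c x)) c).
  by have /negP[] := acf c Uc c_gt2; apply: cycle_from_next.
have f'x : f' x (next c x) by apply: next_cycle.
have [i s Dc] := rot_to xc.
have Us : uniq (x :: s) by rewrite -Dc rot_uniq.
have cs : cycle f' (x :: s) by rewrite -Dc rot_cycle.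
have sz : 2 < size (x :: s) by rewrite -Dc size_rot.
have := next_rot i Uc x; rewrite Dc => Dn.
case: s {Dc} Us cs sz Dn => // y s Us cs sz Dn.
move: Dn; rewrite /= eqxx => Dn; rewrite -Dn in nf f'x.
have xy_ab : (x == a) && (y == b) || (x == b) && (y == a).
  by move: f'x; rewrite /f' (negPf nf).
have nab u v : f' u v -> ~~ f u v -> (u == x) && (v == y) || (u == y) && (v == x).
  rewrite /f' => /or3P[->//|/andP[/eqP-> /eqP->] _|/andP[/eqP-> /eqP->] _];
  by case/orP: xy_ab => /andP[/eqP-> /eqP->]; rewrite !eqxx ?orbT.
(* The rest of the cycle avoids the new edge, hence joins its ends inside [f]. *)
have cyx : connect f y x.
  case: s Us cs sz {Dn} => // z s Us cs _.
  move: cs; rewrite /= rcons_path => /and3P[_ f'yz /andP[f's f'lx]].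
  move: Us; rewrite /= !inE !negb_or => /and3P[/and3P[nxy nxz nxs] /andP[nyz nys] /andP[nzs Us]].
  have fs : path f z s.
    move: f's nxs nys nxz nyz {Us nzs f'lx f'yz}; elim: s z => //= w s IHs z /andP[f'zw f's].
    rewrite !inE !negb_or => /andP[nxw nxs] /andP[nyw nys] nxz nyz.
    rewrite IHs // andbT; apply: contraT => nf'.
    by have := nab _ _ f'zw nf'; rewrite ![z == _]eq_sym (negPf nxz) (negPf nyz).
  have lzs : last z s \in z :: s by apply: mem_last.
  have ny_l : y != last z s.
    by apply: contraTneq lzs => <-; rewrite inE negb_or nyz.
  have fyz : f y z.
    apply: contraT => nf'; have := nab _ _ f'yz nf'.
    by rewrite ![z == _]eq_sym (negPf nxz) (negPf nyz) !andbF.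
  have nx_l : x != last z s.
    by apply: contraTneq lzs => <-; rewrite inE negb_or nxz.
  have flx : f (last z s) x.
    apply: contraT => nf'; have := nab _ _ f'lx nf'.
    by rewrite ![last _ _ == _]eq_sym (negPf nx_l) (negPf ny_l).
  apply/connectP; exists (z :: rcons s x); rewrite /= ?last_rcons // rcons_path.
  by rewrite fyz fs.
case/negP: ncab; case/orP: xy_ab => /andP[/eqP<- /eqP<-] //.
by rewrite (sym_connect_sym symf).
Qed.

(** As long as an edge of [e] joins two components of [E], adding it keeps [E] acyclic. Once there
    is no such edge, connectedness of [e] makes [E] spanning. *)
Lemma extend_to_spanning_tree (T : finType) (e : rel T) (E : {set T * T}) :
  symmetric e -> connected_graph e -> symmetric (tree_rel E) ->
  subrel (tree_rel E) e -> acyclic (tree_rel E) -> 0 < #|T| ->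
  exists2 E' : {set T * T}, E \subset E' & subtree_of e (setT, E').
Proof.
move=> syme conn_e + + + T_gt0; have [n] := ubnP #|~: E|.
elim: n E => // n IHn E leEn symE subE acE.
have [/forallP conE|] := boolP [forall a, forall b, e a b ==> connect (tree_rel E) a b].
  exists E => //; split=> //.
  - by apply/set0Pn; case/card_gt0P: T_gt0 => x _; exists x; rewrite inE.
  - move=> x y xyE; rewrite !inE; split=> //; first exact: subE.
    by have := symE x y; rewrite /tree_rel xyE.
  - move=> x y _ _; apply: connect_sub (conn_e x y) => a b eab.
    by have /forallP /(_ b) /implyP /(_ eab) := conE a.
rewrite negb_forall => /existsP[a]; rewrite negb_forall => /existsP[b].
rewrite negb_imply => /andP[eab ncab].
pose E1 := (a, b) |: ((b, a) |: E).
have E1E x y : tree_rel E1 x y =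
    [|| tree_rel E x y, (x == a) && (y == b) | (x == b) && (y == a)].
  by rewrite /tree_rel !inE !xpair_eqE orbA orbC.
have abE : (a, b) \notin E by apply: contra ncab => abE; apply: connect1.
have [|x y|x y|c Uc sz|E' sE1 trE'] := IHn E1.
- apply: leq_trans (_ : #|~: E| <= n) => //; apply: proper_card.
  rewrite properC; apply/properP; split; last by exists (a, b); rewrite // !inE eqxx.
  by apply/subsetP=> z zE; rewrite !inE zE !orbT.
- rewrite !E1E symE; congr (_ || _).
  by rewrite orbC [(x == b) && _]andbC [(x == a) && _]andbC.
- rewrite E1E => /or3P[/subE//|/andP[/eqP-> /eqP->]//|/andP[/eqP-> /eqP->]].
  by rewrite syme.
- by rewrite (eq_cycle E1E); apply: acyclic_add_edge.
- exists E' => //; apply: subset_trans sE1.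
  by apply/subsetP=> z zE; rewrite !inE zE !orbT.
Qed.

(** * Connected sets and clique minors *)

Definition connected_set (T : finType) (e : rel T) (A : {set T}) : Prop :=
  forall x y, x \in A -> y \in A -> connect (induced e A) x y.

Definition boundary (T : finType) (e : rel T) (A : {set T}) : {set T} :=
  [set z | (z \notin A) && [exists y in A, e y z]].

Lemma boundaryP (T : finType) (e : rel T) (A : {set T}) (z : T) :
  reflect (z \notin A /\ exists2 y, y \in A & e y z) (z \in boundary e A).
Proof.
rewrite inE; apply: (iffP andP) => -[zA]; first by move=> /exists_inP[y]; split=> //; exists y.
by move=> [y yA eyz]; split=> //; apply/exists_inP; exists y.
Qed.

Lemma induced_sym (T : finType) (e : rel T) (A : {set T}) :
  symmetric e -> symmetric (induced e A).
Proof. by move=> sym_e x y; rewrite /induced sym_e [(_ \in A) && _]andbC. Qed.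

Lemma induced_sub (T : finType) (e : rel T) (A B : {set T}) :
  A \subset B -> subrel (induced e A) (induced e B).
Proof. by move=> /subsetP sAB x y /and3P[exy /sAB xB /sAB yB]; apply/and3P. Qed.

Lemma connect_induced_sub (T : finType) (e : rel T) (A B : {set T}) (x y : T) :
  A \subset B -> connect (induced e A) x y -> connect (induced e B) x y.
Proof.
by move=> sAB; apply: connect_sub => a b /(induced_sub sAB) /connect1.
Qed.

Lemma path_induced (T : finType) (e : rel T) (A : {set T}) (x : T) (p : seq T) :
  path e x p -> {subset x :: p <= A} -> path (induced e A) x p.
Proof.
elim: p x => //= y p IHp x /andP[exy ep] sA.
rewrite IHp // ?andbT; last by move=> z zp; apply: sA; rewrite inE zp orbT.
by rewrite /induced exy !sA ?inE ?eqxx ?orbT.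
Qed.

Lemma path_induced_mem (T : finType) (e : rel T) (A : {set T}) (x : T) (p : seq T) :
  path (induced e A) x p -> x \in A -> {subset x :: p <= A}.
Proof.
elim: p x => [|y p IHp] x /=; first by move=> _ xA z; rewrite inE => /eqP->.
move=> /andP[/and3P[_ _ yA] ip] xA z; rewrite inE => /orP[/eqP->//|].
exact: IHp.
Qed.

Lemma connect_induced_mem (T : finType) (e : rel T) (A : {set T}) (x y : T) :
  connect (induced e A) x y -> x \in A -> y \in A.
Proof.
move=> /connectP[p ip ->] xA; exact: (path_induced_mem ip xA) (mem_last x p).
Qed.

Lemma connected_set_exit (T : finType) (e : rel T) (A B : {set T}) (x y : T) :
  connected_set e A -> x \in A -> y \in A -> x \in B -> y \notin B ->
  exists a b, [/\ a \in A :&: B, b \in A :\: B & e a b].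
Proof.
move=> cA xA yA; have /connectP[p ip ->] := cA x y xA yA.
elim: p x xA ip => [|z p IHp] x xA /=; first by move=> _ ->.
move=> /andP[/and3P[exz _ zA] ip] xB lB.
have [zB|zB] := boolP (z \in B); first exact: IHp zA ip zB lB.
by exists x, z; rewrite !inE xA xB zA zB.
Qed.

Lemma K_minor_of_family (T : finType) (e : rel T) (I : finType) (F : {set I})
    (br : I -> {set T}) (r : nat) :
  r <= #|F| ->
  (forall S, S \in F -> br S != set0) ->
  (forall S, S \in F -> connected_set e (br S)) ->
  (forall S S', S \in F -> S' \in F -> S != S' -> [disjoint br S & br S']) ->
  (forall S S', S \in F -> S' \in F -> S != S' ->
     exists x y, [/\ x \in br S, y \in br S' & e x y]) ->
  has_K_minor e r.
Proof.
move=> le_rF ne cn dj adj.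
pose g (i : 'I_r) : I := enum_val (widen_ord le_rF i).
have gF i : g i \in F by apply: enum_valP.
have gI i j : i != j -> g i != g j.
  apply: contraNneq => /enum_val_inj /(congr1 val) /= ij.
  exact/eqP/val_inj.
exists (fun i => br (g i)); split=> [i|i x y xi yi|i j ij|i j ij].
- exact: ne.
- exact: cn.
- by apply: dj => //; apply: gI.
- by apply: adj => //; apply: gI.
Qed.

(** [H] is the union of one geodesic of [G[C]] from [v0] to each [w i]. The centre is counted apart
    from the geodesics, whence the successor in [#|F|.+1]. *)
Lemma geodesic_star (T : finType) (e : rel T) (C : {set T}) (v0 : T)
    (I : finType) (F : {set I}) (w : I -> T) :
  symmetric e -> connected_set e C -> v0 \in C -> (forall i, i \in F -> w i \in C) ->
  exists H : {set T}, [/\ H \subset C, v0 \in H, connected_set e H,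
    forall i, i \in F -> w i \in H &
    forall y k, y \in C ->
      #|[set m in H | dist (induced e C) y m <= k]| <= #|F|.+1 * k.*2.+1].
Proof.
move=> sym_e cC v0C wC.
have symC := induced_sym C sym_e.
have /fin_all_exists [p pP] : forall i, exists p, i \in F ->
    [/\ path (induced e C) v0 p, last v0 p = w i & size p = dist (induced e C) v0 (w i)].
  move=> i; have [iF|_] := boolP (i \in F); last by exists [::].
  by have [q qP] := dist_path (cC v0 (w i) v0C (wC i iF)); exists q.
pose H := v0 |: \bigcup_(i in F) [set x | x \in p i].
have pC i : i \in F -> {subset v0 :: p i <= C}.
  by move=> /pP[ip _ _]; exact: path_induced_mem ip v0C.
have pH i : i \in F -> {subset v0 :: p i <= H}.
  move=> iF z; rewrite !inE => /orP[->//|zp]; apply/orP; right.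
  by apply/bigcupP; exists i; rewrite ?inE.
have HP z : z \in H -> z = v0 \/ exists2 i, i \in F & z \in p i.
  rewrite !inE => /orP[/eqP|/bigcupP[i iF]]; first by left.
  by rewrite inE; right; exists i.
have conH z : z \in H -> connect (induced e H) v0 z.
  case/HP=> [->|[i iF zp]]; first exact: connect0.
  have [ip _ _] := pP i iF.
  have ep : path e v0 (p i) by apply: sub_path ip => a b /and3P[].
  by apply: (path_connect (path_induced ep (pH i iF))); rewrite inE zp orbT.
exists H; split.
- by apply/subsetP=> z /HP[->//|[i iF zp]]; apply: (pC i iF); rewrite inE zp orbT.
- by rewrite !inE eqxx.
- move=> x y xH yH; apply: connect_trans (conH y yH).
  by rewrite (sym_connect_sym (induced_sym H sym_e)) conH.
- by move=> i iF; apply: (pH i iF); have [_ <- _] := pP i iF; apply: mem_last.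
(* The vertices of a geodesic are determined by their distance to [v0], which
   takes at most [2k+1] values on a ball of radius [k]. *)
move=> y k yC; set B := [set m in H | _].
pose d0 := dist (induced e C) v0 y.
(* The second index is the offset above [d0 - k] of the distance from [v0]; truncation at [0] only
   shortens the range. *)
pose f (ij : I * 'I_(k.*2.+1)) := nth v0 (v0 :: p ij.1) (d0 - k + ij.2).
have sub : B \subset v0 |: f @: setX F setT.
  apply/subsetP=> m; rewrite inE => /andP[mH dm]; rewrite !inE.
  case: (HP m mH) => [->|[i iF mp]]; first by rewrite eqxx.
  have mC : m \in C by apply: (pC i iF); rewrite inE mp orbT.
  have [ip lp geo] := pP i iF; rewrite -lp in geo.
  have Dm := geodesic_mem ip geo mp.
  have t1 := dist_triangle (cC v0 y v0C yC) (cC y m yC mC).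
  have t2 := dist_triangle (cC v0 m v0C mC) (cC m y mC yC).
  rewrite (dist_sym symC (cC m y mC yC)) -/d0 in t2; rewrite -/d0 in t1.
  have lt_j : dist (induced e C) v0 m - (d0 - k) < k.*2.+1 by lia.
  apply/orP; right; apply/imsetP; exists (i, Ordinal lt_j); first by rewrite !inE iF.
  by rewrite /f /= subnKC ?Dm //; lia.
apply: leq_trans (subset_leq_card sub) _.
apply: leq_trans (leq_of_leqif (leq_card_setU _ _)) _.
rewrite cards1; have := leq_imset_card f (setX F [set: 'I_(k.*2.+1)]).
by rewrite cardsX cardsT card_ord mulSn; apply: leq_add.
Qed.

(** * The connected decomposition *)

(** The block removed from the component [D]. A component loses a vertex when it is processed and
    never recurs, so blocks can be named by their components. *)
Definition fiber (T : finType) (U : {set T}) (node : T -> {set T}) (D : {set T}) : {set T} :=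
  [set z in ~: U | node z == D].

(* [U] is the set of vertices not yet processed, and [node m] is the component
   of unprocessed vertices containing [m] just before [m] was processed. *)
Record partial_decomposition (T : finType) (e : rel T) (r : nat) (U : {set T})
    (node : T -> {set T}) : Prop := PartialDecomposition {
  pd_mem : forall x, x \notin U -> x \in node x;
  pd_conn : forall x, x \notin U -> connected_set e (node x);
  pd_nested : forall x y, x \notin U -> y \notin U -> y \in node x ->
    node y \subset node x;
  pd_laminar : forall x y w, x \notin U -> y \notin U -> w \in node x -> w \in node y ->
    node x \subset node y \/ node y \subset node x;
  pd_boundary : forall x z, x \notin U -> z \in boundary e (node x) -> z \notin U;
  pd_path : forall x p, path e x p -> ~~ all (mem U) (x :: p) ->
    exists m, [/\ m \notin U, m \in x :: p & {subset x :: p <= node m}];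
  pd_thin : forall x y k, x \notin U -> y \in node x ->
    #|[set m in fiber U node (node x) | dist (induced e (node x)) y m <= k]|
      <= r * k.*2.+1;
  pd_degree : forall x, x \notin U -> #|[set node z | z in boundary e (node x)]| < r;
  pd_fiber : forall x, x \notin U -> connected_set e (fiber U node (node x));
  pd_adjacent : forall x x' z z', x \in U -> connect (induced e U) x x' ->
    z \notin U -> z' \notin U -> e x z -> e x' z' -> node z != node z' ->
    exists a b, [/\ a \in fiber U node (node z), b \in fiber U node (node z') & e a b] }.

(** The next block [H] is a geodesic star in the component [C] of [u], with one target next to each
    earlier block adjacent to [C]. Earlier nodes and blocks stay as they are, so only the cases
    involving [H] are new. *)
Lemma decomposition_step (T : finType) (e : rel T) (r : nat) (U : {set T})
    (node : T -> {set T}) (u : T) :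
  symmetric e -> ~ has_K_minor e r ->
  partial_decomposition e r U node -> u \in U ->
  exists (U' : {set T}) node', U' \proper U /\ partial_decomposition e r U' node'.
Proof.
move=> sym_e noK pd uU; have symU := induced_sym U sym_e.
pose C := [set y | connect (induced e U) u y].
have sCU : C \subset U by apply/subsetP=> y; rewrite inE => /connect_induced_mem; apply.
have uC : u \in C by rewrite inE.
have CU y : y \in C -> y \in U by apply: (subsetP sCU).
have C_step y z : y \in C -> e y z -> z \in U -> z \in C.
  move=> yC eyz zU; rewrite inE; apply: (@connect_trans _ _ y); first by rewrite inE in yC.
  by apply: connect1; rewrite /induced eyz zU CU.
have cC : connected_set e C.
  have pre y : y \in C -> connect (induced e C) u y.
    rewrite inE => /connectP[p ip ->].
    have ep : path e u p by apply: sub_path ip => a b /and3P[].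
    apply/connectP; exists p => //; apply: path_induced => // z zp.
    by rewrite inE; apply: (path_connect ip).
  move=> x y xC yC; apply: connect_trans (pre y yC).
  by rewrite (sym_connect_sym (induced_sym C sym_e)) pre.
have bC z : z \in boundary e C -> z \notin U.
  by case/boundaryP=> zC [y yC eyz]; apply: contra zC; apply: C_step eyz.
have C_conn y y' : y \in C -> y' \in C -> connect (induced e U) y y'.
  by move=> yC y'C; apply: connect_induced_sub sCU (cC _ _ yC y'C).
have nodeC z : z \notin U -> node z != C.
  by move=> zU; apply: contraNneq (zU) => DC; apply: CU; rewrite -DC (pd_mem pd).
(* A path in [C] cannot leave [node x]: it would pass through the boundary of [node x], which is
   already processed. *)
have C_sub x y : x \notin U -> y \in C -> y \in node x -> C \subset node x.
  move=> xU yC yx; apply/subsetP=> z zC; apply: contraT => zx.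
  have [a [b []]] := connected_set_exit cC yC zC yx zx.
  rewrite !inE => /andP[aC ax] /andP[bx bC'] eab.
  have : b \notin U by apply: (pd_boundary pd xU); apply/boundaryP; split=> //; exists a.
  by rewrite CU // inE.
pose fam := [set node z | z in boundary e C].
have famP S : S \in fam -> exists w z, [/\ w \in C, z \notin U, node z = S & e w z].
  case/imsetP=> z zb ->; have /boundaryP[_ [w wC ewz]] := zb.
  by exists w, z; split=> //; apply: bC.
have Cfam : C \notin fam.
  by apply/negP => /famP[w [z [_ zU DC _]]]; have := nodeC z zU; rewrite DC eqxx.
(* The blocks in [fam] are pairwise adjacent by [pd_adjacent]; with [C] as one more branch set they
   form a clique minor of order [#|fam|.+1]. *)
have fam_small : #|fam|.+1 < r.
  rewrite ltnNge; apply/negP => le_r; apply: noK.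
  (* [C] has no block yet, so it serves as its own branch set. *)
  pose br S := if S == C then C else fiber U node S.
  have brC : br C = C by rewrite /br eqxx.
  have brf S : S \in fam -> br S = fiber U node S.
    by move=> SF; rewrite /br; case: eqP SF => // ->; rewrite (negPf Cfam).
  have C_br S : S \in fam -> exists x y, [/\ x \in C, y \in br S & e x y].
    move=> SF; have [w [z [wC zU DS ewz]]] := famP S SF.
    by exists w, z; split=> //; rewrite brf ?DS // !inE zU DS eqxx.
  apply: (@K_minor_of_family _ e _ (C |: fam) br); first by rewrite cardsU1 Cfam.
  - move=> S /setU1P[->|SF]; first by rewrite brC; apply/set0Pn; exists u.
    by have [x [y [_ yS _]]] := C_br S SF; apply/set0Pn; exists y.
  - move=> S /setU1P[->|SF]; first by rewrite brC.
    have [w [z [_ zU DS _]]] := famP S SF.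
    by rewrite brf // -DS; exact: (pd_fiber pd zU).
  - have dC S : S \in fam -> [disjoint C & br S].
      move=> SF; rewrite brf //; apply/pred0P => z /=; apply/negP => /andP[zC].
      by rewrite !inE CU.
    move=> S S' /setU1P[->|SF] /setU1P[->|SF'] neq; rewrite ?brC ?eqxx // in neq *.
    + exact: dC.
    + by rewrite disjoint_sym dC.
    + rewrite !brf //; apply/pred0P => z /=; apply/negP => /andP[].
      rewrite !inE => /andP[_ /eqP ->] /andP[_ /eqP DS].
      by rewrite DS eqxx in neq.
  - move=> S S' /setU1P[->|SF] /setU1P[->|SF'] neq; rewrite ?brC ?eqxx // in neq *.
    + exact: C_br.
    + have [x [y [xC yS exy]]] := C_br S SF.
      by exists y, x; split=> //; rewrite sym_e.
    + rewrite !brf //.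
      have [w [z [wC zU DS ewz]]] := famP S SF.
      have [w' [z' [wC' zU' DS' ewz']]] := famP S' SF'.
      rewrite -DS -DS' in neq *.
      exact: (pd_adjacent pd (CU _ wC) (C_conn _ _ wC wC') zU zU' ewz ewz' neq).
(* The targets of the star: [w S] lies in [C] next to the block of [S]. *)
have /fin_all_exists [w wP] : forall S, exists w, S \in fam ->
    w \in C /\ exists z, [/\ z \notin U, node z = S & e w z].
  move=> S; have [/famP[w [z [wC zU DS ewz]]]|_] := boolP (S \in fam); last by exists u.
  by exists w => _; split=> //; exists z.
have [|H [sHC uH cH wH thinH]] := @geodesic_star _ e C u _ fam w sym_e cC uC.
  by move=> S /wP[].
have HC x : x \in H -> x \in C by apply: (subsetP sHC).
have HU x : x \in H -> x \in U by move=> /HC/CU.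
pose node' x := if x \in H then C else node x.
pose U' := U :\: H.
have nodeH x : x \in H -> node' x = C by rewrite /node' => ->.
have nodeU x : x \notin U -> node' x = node x.
  by move=> xU; rewrite /node'; case: ifP => // /HU xU'; rewrite xU' in xU.
have U'P x : x \notin U' -> x \in H /\ node' x = C \/ x \notin U /\ node' x = node x.
  rewrite inE negb_and negbK; case: (boolP (x \in H)) => [xH|_ /= xU]; last by right; rewrite nodeU.
  by left; rewrite nodeH.
have fibC : fiber U' node' C = H.
  apply/setP=> z; rewrite !inE negb_and negbK.
  have [zH|zH] := boolP (z \in H); first by rewrite nodeH ?eqxx.
  apply/negbTE/negP => /= /andP[zU]; rewrite nodeU // => /eqP DC.
  by have := nodeC z zU; rewrite DC eqxx.
have fibU x : x \notin U -> fiber U' node' (node x) = fiber U node (node x).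
  move=> xU; apply/setP=> z; rewrite !inE negb_and negbK.
  have [zH|zH] /= := boolP (z \in H); last first.
    by case: (boolP (z \in U)) => //= zU; rewrite nodeU.
  by rewrite nodeH // HU // eq_sym (negPf (nodeC x xU)).
exists U', node'; split.
  apply/properP; split; first by apply: subsetDl.
  by exists u => //; rewrite !inE uH.
split.
- move=> x /U'P[][xU ->]; first exact: HC.
  exact: (pd_mem pd).
- move=> x /U'P[][xU ->]; first exact: cC.
  exact: (pd_conn pd).
- move=> x y /U'P[][xU ->] /U'P[][yU ->].
  + by [].
  + by move=> /CU yU'; rewrite yU' in yU.
  + by move=> yx; apply: C_sub yx; rewrite ?HC.
  + exact: (pd_nested pd xU yU).
- move=> x y v /U'P[][xU ->] /U'P[][yU ->].
  + by left.
  + by move=> vC vy; left; apply: C_sub vy.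
  + by move=> vx vC; right; apply: C_sub vx.
  + exact: (pd_laminar pd xU yU).
- move=> x z xU' zb; suff zU : z \notin U by rewrite inE (negPf zU) andbF.
  case/U'P: xU' zb => -[xU ->]; first exact: bC.
  exact: (pd_boundary pd xU).
(* A path with an earlier processed vertex keeps its old witness. Otherwise it lies in [U] and meets
   [H], so it stays within the component [C], and any of its vertices in [H] is a witness. *)
- move=> x p ep; have [/allP allU nall|notU _] := boolP (all (mem U) (x :: p)); last first.
    have [m [mU mp sub]] := pd_path pd ep notU.
    by exists m; rewrite nodeU //; split=> //; rewrite inE (negPf mU) andbF.
  have [m mp mH] : exists2 m, m \in x :: p & m \in H.
    have /allPn[m mp mU'] := nall; exists m => //.
    by case: (U'P m mU') => -[] //; have := allU m mp; rewrite /= => ->.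
  exists m; split=> //; first by rewrite inE mH.
  rewrite nodeH // => y yp; have ip : path (induced e U) x p by apply: path_induced.
  have := HC m mH; rewrite !inE => um; apply: connect_trans um _.
  apply: (@connect_trans _ _ x); last exact: (path_connect ip).
  by rewrite (sym_connect_sym symU); apply: (path_connect ip).
- move=> x y k /U'P[][xU ->]; last first.
    by rewrite fibU //; apply: (pd_thin pd k xU).
  rewrite fibC => yC; apply: leq_trans (thinH y k yC) _.
  by rewrite leq_mul2r ltnW ?orbT.
- have famE A : (forall z, z \in boundary e A -> z \notin U) ->
      [set node' z | z in boundary e A] = [set node z | z in boundary e A].
    by move=> bA; apply: eq_in_imset => z /bA; apply: nodeU.
  move=> x /U'P[][xU ->].
    by rewrite famE //; apply: ltnW.
  rewrite famE; first exact: (pd_degree pd xU).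
  by move=> z; apply: (pd_boundary pd xU).
- move=> x /U'P[][xU ->]; rewrite ?fibC ?fibU //.
  exact: (pd_fiber pd xU).
(* A remaining component that touches [H] lies in [C], so every other block it touches belongs to
   [fam] and is reached by the star. *)
- have H_touch x z : x \in C -> z \notin U -> e x z ->
      exists a b, [/\ a \in H, b \in fiber U node (node z) & e a b].
    move=> xC zU exz; have zF : node z \in fam.
      apply: imset_f; apply/boundaryP; split; last by exists x.
      by apply: contra zU; apply: CU.
    have [_ [b [bU Db ewb]]] := wP _ zF; exists (w (node z)), b; split=> //.
      exact: wH.
    by rewrite !inE bU Db eqxx.
  move=> x x' z z' xU' cxx' zU' zU'' exz exz'.
  have sU'U : U' \subset U by apply: subsetDl.
  have xU : x \in U by apply: (subsetP sU'U).
  have cU : connect (induced e U) x x' by apply: connect_induced_sub cxx'.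
  have xU2 : x' \in U by apply: connect_induced_mem cU xU.
  case/U'P: zU' => -[zH ->]; case/U'P: zU'' => -[zH' ->].
  + by rewrite eqxx.
  + rewrite fibC fibU // => _; apply: H_touch exz' => //.
    have xC : x \in C by apply: (C_step z) => //; [apply: HC | rewrite sym_e].
    by move: xC; rewrite !inE => ux; apply: connect_trans ux cU.
  + rewrite fibC fibU // => _.
    have xC' : x' \in C by apply: (C_step z') => //; [apply: HC | rewrite sym_e].
    have xC : x \in C.
      move: xC'; rewrite !inE => ux; apply: connect_trans ux _.
      by rewrite (sym_connect_sym symU).
    have [a [b [aH bz eab]]] := H_touch x z xC zH exz.
    by exists b, a; split=> //; rewrite sym_e.
  + by rewrite !fibU //; exact: (pd_adjacent pd xU cU zH zH' exz exz').
Qed.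

Lemma decomposition_exists (T : finType) (e : rel T) (r : nat) :
  symmetric e -> ~ has_K_minor e r ->
  exists node, partial_decomposition e r set0 node.
Proof.
move=> sym_e noK.
suff ind n : forall (U : {set T}) node, #|U| < n -> partial_decomposition e r U node ->
    exists node', partial_decomposition e r set0 node'.
  apply: (ind #|T|.+1 setT (fun=> set0)); first by rewrite cardsT.
  split=> [x|x|x y|x y w|x z|x p _ nall|x y k|x|x|x x' z z' _ _]; rewrite ?inE //.
  by case/negP: nall; apply/allP => z _; rewrite /= inE.
elim: n => // n IHn U node ltU pd.
have [U0|[u uU]] := set_0Vmem U; first by exists node; rewrite -U0.
have [U' [node' [ltU' pd']]] := decomposition_step sym_e noK pd uU.
by apply: IHn pd'; apply: leq_trans (proper_card ltU') _.
Qed.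

(** * Counting the vertices whose balls reach a given vertex *)

Lemma card_bigcup_le (I T : finType) (A : {set I}) (F : I -> {set T}) (n : nat) :
  (forall i, i \in A -> #|F i| <= n) -> #|\bigcup_(i in A) F i| <= #|A| * n.
Proof.
move=> leF; rewrite -sum_nat_const.
apply: (big_ind2 (fun (X : {set T}) (s : nat) => #|X| <= s)) => //; first by rewrite cards0.
move=> X s Y t leX leY; apply: leq_trans (leq_add leX leY).
by rewrite cardsU leq_subr.
Qed.

(* A path leaving [node x] first hits one of the fewer than [r] sets [node z]
   with [z] on the boundary of [node x], and then has one step less to go. *)
Lemma decomposition_ancestors (T : finType) (e : rel T) (r : nat) (node : T -> {set T})
    (x : T) (k : nat) :
  partial_decomposition e r set0 node ->
  #|[set node m | m in [set m | [exists y in node x,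
      (node x \subset node m) && (dist (induced e (node m)) y m <= k)]]]| <= r ^ k.
Proof.
move=> pd; have n0 (z : T) : z \notin set0 by rewrite inE.
have r_gt0 : 0 < r by apply: leq_ltn_trans (pd_degree pd (n0 x)).
pose near j (D : {set T}) := [set node m | m in [set m | [exists y in D,
  (D \subset node m) && (dist (induced e (node m)) y m <= j)]]].
have nearP j z B : reflect (exists m y, [/\ y \in node z, node z \subset node m,
    dist (induced e (node m)) y m <= j & B = node m]) (B \in near j (node z)).
  apply: (iffP imsetP) => [[m]|[m [y [yz sub dj ->]]]].
    by rewrite inE => /exists_inP[y yz /andP[sub dj]] ->; exists m, y.
  by exists m => //; rewrite inE; apply/exists_inP; exists y; rewrite ?sub.
rewrite -/(near k (node x)); elim: k x => [|k IHk] x.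
  (* At distance [0] the vertex [m] is itself in [node x], so both nodes coincide. *)
  suff sub : near 0 (node x) \subset [set node x].
    by have := subset_leq_card sub; rewrite cards1.
  apply/subsetP=> _ /nearP[m [y [yx sub d0 ->]]].
  have ym := subsetP sub y yx.
  have [[|a s] [_ /= ymE sz]] := dist_path (pd_conn pd (n0 m) ym (pd_mem pd (n0 m))); last first.
    by rewrite -sz in d0.
  rewrite inE eqEsubset sub andbT; apply: (pd_nested pd) => //.
  by rewrite -ymE.
pose adj := [set node v | v in boundary e (node x)].
have sub : near k.+1 (node x) \subset node x |: \bigcup_(B in adj) near k B.
  apply/subsetP=> _ /nearP[m [y [yx sub dk ->]]]; rewrite in_setU1.
  have [mx|mx] := boolP (m \in node x).
    by rewrite eqEsubset sub andbT (pd_nested pd).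
  apply/orP; right; have ym := subsetP sub y yx.
  have [p [ip lp sz]] := dist_path (pd_conn pd (n0 m) ym (pd_mem pd (n0 m))).
  have [a [z [q [ax zx eaz [zm iq lq szq]]]]] : exists a z q, [/\ a \in node x,
      z \notin node x, e a z & [/\ z \in node m, path (induced e (node m)) z q,
      last z q = m & size q <= k]].
    rewrite -sz in dk; elim: p y yx {sz ym} ip lp dk => [|z p IHp] y yx /=.
      by move=> _ ym; rewrite -ym yx in mx.
    move=> /andP[/and3P[eyz _ zm] ip] lp szp.
    have [zx|zx] := boolP (z \in node x); last by exists y, z, p.
    by apply: IHp zx ip lp _; apply: leq_trans szp.
  have zb : z \in boundary e (node x) by apply/boundaryP; split=> //; exists a.
  (* Applied to the single edge from [a] to [z], [pd_path] puts both ends in [node a] or in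
     [node z]. The first is impossible, as [node a] lies in [node x]; in the second, laminarity
     decides the inclusion. *)
  have xz : node x \subset node z.
    have eaz1 : path e a [:: z] by rewrite /= eaz.
    have naz : ~~ all (mem set0) (a :: [:: z]) by rewrite /= inE.
    have [w [_ wp wN]] := pd_path pd eaz1 naz.
    have az : a \in node w by apply: wN; rewrite inE eqxx.
    have zw : z \in node w by apply: wN; rewrite !inE eqxx orbT.
    move: wp; rewrite !inE => /orP[/eqP Dw|/eqP Dw]; rewrite {w wN}Dw in az zw.
      have sax := pd_nested pd (n0 x) (n0 a) ax.
      by rewrite (subsetP sax z zw) in zx.
    have [//|szx] := pd_laminar pd (n0 x) (n0 z) ax az.
    by rewrite (subsetP szx z zw) in zx.
  apply/bigcupP; exists (node z); first exact: imset_f.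
  apply/nearP; exists m, z; split=> //; first exact: (pd_mem pd).
    exact: (pd_nested pd).
  by have := dist_le iq; rewrite lq => le_d; apply: leq_trans le_d szq.
apply: leq_trans (subset_leq_card sub) _.
rewrite cardsU1; apply: (@leq_trans (1 + #|adj| * r ^ k)).
  apply: leq_add; first by case: (_ \notin _).
  by apply: card_bigcup_le => _ /imsetP[v _ ->]; apply: IHk.
(* The [1] counting [node x] is paid for by one more [r ^ k]; the strict bound on [#|adj|] leaves
   room for it. *)
apply: (@leq_trans (#|adj|.+1 * r ^ k)).
  by rewrite mulSn leq_add2r expn_gt0 r_gt0.
by rewrite expnS leq_mul2r (pd_degree pd (n0 x)) orbT.
Qed.

(** The vertices [m] are grouped by their node: at most [r ^ k] nodes occur, and thinness bounds the
    part of each block within distance [k] of [x]. *)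
Lemma decomposition_ball (T : finType) (e : rel T) (r : nat) (node : T -> {set T})
    (x : T) (k : nat) :
  partial_decomposition e r set0 node ->
  #|[set m | (x \in node m) && (dist (induced e (node m)) x m <= k)]|
    <= r ^ k * (r * k.*2.+1).
Proof.
move=> pd; have n0 (z : T) : z \notin set0 by rewrite inE.
pose A := [set node m | m in [set m | [exists y in node x,
      (node x \subset node m) && (dist (induced e (node m)) y m <= k)]]].
pose ball (B : {set T}) := if x \in B then
  [set m in fiber set0 node B | dist (induced e B) x m <= k] else set0.
apply: (@leq_trans #|\bigcup_(B in A) ball B|).
  apply/subset_leq_card/subsetP=> m; rewrite inE => /andP[xm dk].
  apply/bigcupP; exists (node m); last by rewrite /ball xm !inE eqxx.
  apply: imset_f; rewrite inE; apply/exists_inP; exists x; first exact: (pd_mem pd).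
  by rewrite dk andbT (pd_nested pd).
apply: (@leq_trans (#|A| * (r * k.*2.+1))); last first.
  by rewrite leq_mul2r (decomposition_ancestors x k pd) orbT.
apply: card_bigcup_le => _ /imsetP[m _ ->]; rewrite /ball.
by case: ifP => [xm|_]; [apply: (pd_thin pd) | rewrite cards0].
Qed.

(** * The tree cover *)

Definition cluster (T : finType) (e : rel T) (node : T -> {set T}) (D : nat) (m x : T) : bool :=
  (x \in node m) && (dist (induced e (node m)) m x <= D).

(** BFS trees in disjoint clusters form a forest, with the distance to the own centre as height. Any
    spanning tree extending it contains the path of parents from [x] to [m], a geodesic of
    [G[node m]]. *)
Lemma cluster_tree (T : finType) (e : rel T) (node : T -> {set T}) (D : nat) (M : {set T}) :
  symmetric e -> connected_graph e -> 0 < #|T| ->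
  (forall m, m \in M -> m \in node m) ->
  (forall m, m \in M -> connected_set e (node m)) ->
  (forall m m' x, m \in M -> m' \in M -> cluster e node D m x -> cluster e node D m' x ->
     m = m') ->
  exists2 E, subtree_of e (setT, E) & forall m x, m \in M -> cluster e node D m x ->
    exists p, [/\ path (tree_rel E) m p, last m p = x &
                  size p = dist (induced e (node m)) m x].
Proof.
move=> sym_e conn_e T_gt0 memM connM disjM.
pose d m := dist (induced e (node m)) m.
have /fin_all_exists [par parP] : forall mx : T * T, exists y, mx.1 \in M ->
    mx.2 \in node mx.1 -> mx.2 != mx.1 ->
    [/\ y \in node mx.1, e y mx.2 & d mx.1 mx.2 = (d mx.1 y).+1].
  move=> [m x] /=; have [/and3P[mM xm nxm]|no] := boolP [&& m \in M, x \in node m & x != m].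
    have [y [_ /and3P[eyx ym _] dE]] := dist_pred (connM m mM m x (memM m mM) xm) nxm.
    by exists y.
  by exists x => mM xm nxm; rewrite mM xm nxm in no.
pose up x y := [exists m in M, [&& cluster e node D m x, x != m & y == par (m, x)]].
have upP x y : up x y -> exists m, [/\ m \in M, cluster e node D m x,
    cluster e node D m y, e x y & y = par (m, x) /\ d m x = (d m y).+1].
  move=> /exists_inP[m mM /and3P[clx nxm /eqP ->]]; exists m.
  have /andP[xm dx] := clx; have [ym eyx dE] := parP (m, x) mM xm nxm.
  split=> //; first by rewrite /cluster ym; move: dE dx => /=; rewrite /d; lia.
  by rewrite sym_e.
(* The centre of the unique cluster containing [x]. The default concerns vertices outside all
   clusters, which no forest edge meets. *)
pose cen x := odflt x [pick m in M | cluster e node D m x].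
have cenE m x : m \in M -> cluster e node D m x -> cen x = m.
  move=> mM clx; rewrite /cen; case: pickP => [m' /andP[m'M clx']|/(_ m)] /=.
    exact: disjM clx.
  by rewrite mM clx.
pose E0 := [set z : T * T | up z.1 z.2 || up z.2 z.1].
have E0E x y : tree_rel E0 x y = up x y || up y x by rewrite /tree_rel inE.
have sym0 : symmetric (tree_rel E0) by move=> x y; rewrite !E0E orbC.
have sub0 : subrel (tree_rel E0) e.
  move=> x y; rewrite E0E => /orP[]/upP[m [_ _ _ exy _]] //.
  by rewrite sym_e.
have ac0 : acyclic (tree_rel E0).
  apply: (@acyclic_parent _ _ (fun x => par (cen x, x)) (fun x => d (cen x) x)) => //.
  have upc x y : up x y -> par (cen x, x) = y /\ d (cen y) y < d (cen x) x.
    by move=> /upP[m [mM clx cly _ [yE dE]]]; rewrite (cenE m x) // (cenE m y) // dE yE.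
  by move=> x y; rewrite E0E => /orP[]/upc; [left|right].
have [E sE trE] := extend_to_spanning_tree sym_e conn_e sym0 sub0 ac0 T_gt0.
exists E => // m x mM; have [n] := ubnP (d m x); elim: n x => // n IHn x ltn clx.
have [->|nxm] := eqVneq x m; first by exists [::]; rewrite dist_xx.
have /andP[xm dx] := clx; have [ym eyx dE] := parP (m, x) mM xm nxm.
have [] := IHn (par (m, x)).
- by move: dE ltn => /=; lia.
- by rewrite /cluster ym; move: dE dx => /=; rewrite /d; lia.
move=> p [ip lp sz]; exists (rcons p x); split; last 2 first.
- by rewrite last_rcons.
- by rewrite size_rcons sz -/(d m x) dE.
rewrite rcons_path ip lp; apply: (subsetP sE); rewrite inE /=; apply/orP; right.
by apply/exists_inP; exists m; rewrite // clx nxm eqxx.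
Qed.

(** From [r <= 2 ^ r] and [4D + 1 <= 2 ^ (4D)] the exponent is at most [2rD + r + 4D], and [r <= rD]
    because [D] is positive. *)
Lemma color_count_bound (r D : nat) : 0 < D ->
  r ^ D.*2 * (r * D.*2.*2.+1) <= 2 ^ ((3 * r + 4) * D).
Proof.
move=> D_gt0; have le_r : r <= 2 ^ r by apply/ltnW/ltn_expl.
have le_D : D.*2.*2.+1 <= 2 ^ D.*2.*2 by apply: ltn_expl.
apply: (@leq_trans ((2 ^ r) ^ D.*2 * (2 ^ r * 2 ^ D.*2.*2))).
  by rewrite leq_mul // ?leq_mul // leq_exp2r // double_gt0.
rewrite -expnM -!expnD leq_exp2l //.
have : r <= r * D by apply: leq_pmulr.
by rewrite -!mul2n; lia.
Qed.

Theorem theorem1p4 (r : nat) (hr : 1 <= r) :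
  exists c : nat,
  forall (T : finType) (e : rel T),
    symmetric e -> irreflexive e -> connected_graph e -> ~ has_K_minor e r ->
    exists F : seq ({set T} * {set T * T}),
      [/\ size F <= 2 ^ (c * diameter e),
          forall t, t \in F -> subtree_of e t &
          forall u v : T, exists2 t, t \in F &
            [/\ u \in t.1, v \in t.1 & dist (tree_rel t.2) u v = dist e u v]].
Proof.
exists (3 * r + 4) => T e sym_e _ conn_e noK.
have [T0|T_gt0] := posnP #|T|.
  exists [::]; split=> // u; by have := fintype0 u T0.
have dist_diam u v : dist e u v <= diameter e.
  exact: (leq_bigmax (F := fun p : T * T => dist e p.1 p.2) (u, v)).
(* For diameter [0] only one tree is allowed; all vertices coincide, so any spanning tree will
   do. *)
have [D0|D_gt0] := posnP (diameter e).
  have [E _ trE] : exists2 E : {set T * T}, set0 \subset E & subtree_of e (setT, E).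
    apply: (@extend_to_spanning_tree _ e set0) => //.
    - by move=> x y; rewrite /tree_rel !in_set0.
    - by move=> x y; rewrite /tree_rel in_set0.
    - by move=> [|x [|y c]] //= _ _; rewrite /tree_rel in_set0.
  exists [:: (setT, E)]; split; first by rewrite expn_gt0.
    by move=> t; rewrite inE => /eqP->.
  move=> u v; exists (setT, E); first exact: mem_head.
  split; rewrite ?in_setT //=.
  have [[|a s] [_ /= uv sz]] := dist_path (conn_e u v); first by rewrite -uv !dist_xx.
  by have := dist_diam u v; rewrite D0 -sz.
have [node pd] := decomposition_exists sym_e noK.
have n0 (z : T) : z \notin set0 by rewrite inE.
pose D := diameter e; pose W := r ^ D.*2 * (r * D.*2.*2.+1).
pose cl := cluster e node D.
have symN m := induced_sym (node m) sym_e.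
have cN m x y : x \in node m -> y \in node m -> connect (induced e (node m)) x y.
  exact: (pd_conn pd (n0 m)).
have mN m : m \in node m by apply: (pd_mem pd).
pose conf m m' := [exists x, cl m x && cl m' x].
have sym_conf : symmetric conf by move=> m m'; apply: eq_existsb => x; rewrite andbC.
have [m|col [colW colP]] := @greedy_coloring T conf (fun m => #|~: node m|) W sym_conf.
  (* If [m'] conflicts with [m] and [node m'] is at least as large, laminarity gives [node m] inside
     [node m']; a common vertex of the two balls then puts [m'] within [2D] of [m] in [G[node m']].
     Strictness comes from [m], which lies in the counted set but is not its own conflict. *)
  apply: leq_trans (decomposition_ball m D.*2 pd); apply: proper_card; apply/properP; split.
    apply/subsetP=> m'; rewrite !inE => /and3P[_ /existsP[x /andP[/andP[xm dm] /andP[xm' dm']]] le_m].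
    have sub : node m \subset node m'.
      have [//|sub'] := pd_laminar pd (n0 m) (n0 m') xm xm'.
      have /eqP-> // : node m == node m'.
      rewrite eq_sym eqEcard sub'; have := cardsC (node m); have := cardsC (node m'); lia.
    have mm' := subsetP sub m (mN m); rewrite mm'.
    apply: leq_trans (dist_triangle (cN _ _ _ mm' xm') (cN _ _ _ xm' (mN m'))) _.
    rewrite -addnn leq_add //; last by rewrite (dist_sym (symN m')) //; apply: cN.
    by apply: leq_trans dm; apply: dist_sub (induced_sub sub) (cN _ _ _ (mN m) xm).
  by exists m; rewrite !inE ?eqxx // mN dist_xx.
(* Clusters with centres of one colour are disjoint, so each colour needs a single tree. *)
have /fin_all_exists [E EP] : forall c : 'I_W, exists E, subtree_of e (setT, E) /\
    forall m x, col m = c -> cl m x -> exists p, [/\ path (tree_rel E) m p, last m p = x &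
                  size p = dist (induced e (node m)) m x].
  move=> c.
  have [||m m' x|E trE EP] := @cluster_tree T e node D [set m | col m == c] sym_e conn_e T_gt0.
  - by move=> m _; apply: mN.
  - by move=> m _ x y; apply: cN.
  - rewrite !inE => /eqP Dm /eqP Dm' clm clm'; apply: colP; last by rewrite Dm Dm'.
    by apply/existsP; exists x; rewrite /cl clm.
  exists E; split=> // m x Dm; apply: EP; rewrite inE; exact/eqP.
exists [seq (setT, E c) | c : 'I_W]; split.
- by rewrite size_image card_ord color_count_bound.
- by move=> t /imageP[c _ ->]; have [] := EP c.
move=> u v; have [p [ep lp sz]] := dist_path (conn_e u v).
have nall : ~~ all (mem set0) (u :: p) by rewrite /= inE.
have [m [_ mp subN]] := pd_path pd ep nall.
(* The geodesic runs through [m] inside [node m], so the distances in [G[node m]] from [m] to [u]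
   and [v] add up to at most the distance of [u] and [v] in [G]. Both ends therefore lie in the
   cluster of [m], and the tree path through [m] is short enough. *)
have [cum cmv le_uv] := dist_split (path_induced ep subN) mp.
have uN : u \in node m by apply: subN; rewrite inE eqxx.
have vN : v \in node m by apply: subN; rewrite -lp mem_last.
rewrite lp in cmv le_uv; rewrite (dist_sym (symN m) cum) sz in le_uv.
have le_D := dist_diam u v.
pose c := Ordinal (colW m); have [trE pathE] := EP c.
exists (setT, E c); first exact: image_f.
rewrite !inE; split=> //=.
have [_ subE cE _] := trE.
have sub : subrel (tree_rel (E c)) e by move=> x y /subE[].
have conn x y : connect (tree_rel (E c)) x y by apply: cE; rewrite inE.
have symE : symmetric (tree_rel (E c)) by move=> x y; apply/idP/idP=> /subE[].
apply/eqP; rewrite eqn_leq (dist_sub sub) // andbT.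
have [|pu [tu lu su]] := pathE m u erefl; first by rewrite /cl /cluster uN; lia.
have [|pv [tv lv sv]] := pathE m v erefl; first by rewrite /cl /cluster vN; lia.
apply: leq_trans (dist_triangle (conn u m) (conn m v)) _.
rewrite (dist_sym symE (conn u m)); apply: leq_trans le_uv.
by rewrite -su -sv -{1}lu -{1}lv leq_add ?dist_le.
Qed.
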